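(* Let $T$ be a rooted chain complete tree, endowed with the coarse wedge topology. Then $T$ is a Valdivia compact space if and only if $C(T)$ is a $1$-Plichko space.
   Context: A tree is a partially ordered set $(T,<)$ such that for every $t\in T$ the set $\{s\in T:s<t\}$ is well-ordered by $<$. It is rooted if it has exactly one minimal element, and chain complete if every chain has a supremum. The height of $t$ is the order type of $\{s\in T:s<t\}$; $t$ is on a successor level if its height is a successor ordinal; $V_t=\{s\in T:s\geq t\}$. The coarse wedge topology on $T$ is the topology whose subbase consists of all sets $V_t$ and their complements, where $t$ is either minimal or on a successor level. A rooted chain complete tree is compact Hausdorff in this topology. $C(T)$ is the Banach space of real-valued or complex-valued continuous functions on $T$ with the supremum norm. For a set $\Gamma$ let $\Sigma(\Gamma)=\{x\in\mathbb{R}^\Gamma:|\{\gamma\in\Gamma:x(\gamma)\neq 0\}|\leq\omega_0\}$. For a compact space $K$, a set $A\subset K$ is a $\Sigma$-subset of $K$ if there is a homeomorphic injection $h$ of $K$ into some $\mathbb{R}^\Gamma$ with $h(A)=h(K)\cap\Sigma(\Gamma)$. $K$ is Valdivia if it has a dense $\Sigma$-subset. Let $X$ be a Banach space. A set $D\subset X^*$ is $\lambda$-norming if $\|x\|\leq\lambda\sup\{|x^*(x)|:x^*\in D\cap B_{X^*}\}$ for every $x\in X$, where $B_{X^*}$ is the closed unit ball of $X^*$. A subspace $S\subset X^*$ is a $\Sigma$-subspace of $X^*$ if there is $M\subset X$ with $\overline{\operatorname{span}}(M)=X$ and $S=\{f\in X^*:\{m\in M:f(m)\neq0\}\text{ is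 countable}\}$. $X$ is $\lambda$-Plichko if $X^*$ admits a $\lambda$-norming $\Sigma$-subspace. *)

(* Defs.v *)
From HB Require Import structures.
From mathcomp Require Import all_boot all_order all_algebra.
From mathcomp Require Import all_classical all_reals all_analysis.
From mathcomp Require Import wochoice complex.

Set Implicit Arguments.
Unset Strict Implicit.
Unset Printing Implicit Defensive.

Import Order.TTheory GRing.Theory Num.Theory.
Import numFieldNormedType.Exports.

Local Open Scope classical_set_scope.
Local Open Scope ring_scope.

Definition same_order_type (A B : Type) (R : rel A) (S : rel B) : Prop :=
  exists2 f : A -> B, bijective f & {mono f : x y / R x y >-> S x y}.

(* The ordinal [R + 1]: the well-order [R] with a new greatest element. *)
Definition succ_rel (W : Type) (R : rel W) : rel (option W) :=
  fun x y => match x, y with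
             | _, None => true
             | None, Some _ => false
             | Some a, Some b => R a b
             end.

HB.mixin Record isTree d T & Order.POrder d T := {
  tree_wo_chain : forall t : T, wo_chain <=%O [pred s : T | (s < t)%O]
}.

#[short(type="treeType")]
HB.structure Definition Tree d := {T of Order.POrder d T & isTree d T}.

HB.mixin Record isRootedChainComplete d T & Tree d T := {
  tree_rooted : exists! r : T, wochoice.minimal <=%O r;
  tree_chain_complete : forall C : set T,
    total_on C <=%O -> exists m, isLub C m
}.

#[short(type="rootedChainCompleteTreeType")]
HB.structure Definition RootedChainCompleteTree d :=
  {T of Tree d T & isRootedChainComplete d T}.

Section CoarseWedgeSubbase.
Context {d : Order.disp_t} {T : treeType d}.
Implicit Types s t : T.

Definition below_rel t : rel {s : T | (s < t)%O} :=
  fun x y => (sval x <= sval y)%O.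

(* The height of [t] is the order type of [below_rel t]; it is a successor when
   it equals the successor of some ordinal, ordinals being well-ordered types up
   to isomorphism. *)
Definition successor_level t : Prop :=
  exists (W : Type) (R : rel W),
    well_order R /\ same_order_type (@below_rel t) (succ_rel R).

Definition upset t : set T := [set s | (t <= s)%O].

Definition coarse_wedge_index : set T :=
  [set t | wochoice.minimal <=%O t \/ successor_level t].

Definition coarse_wedge_subbase : set_system T :=
  [set U | exists2 t, coarse_wedge_index t & U = upset t \/ U = ~` upset t].

End CoarseWedgeSubbase.

(* A copy of [T] that carries the coarse wedge topology. *)
Definition coarse_wedge (T : Type) : Type := T.

HB.instance Definition _ d (T : treeType d) := Choice.on (coarse_wedge T).
HB.instance Definition _ d (T : treeType d) :=
  isSubBaseTopological.Build (coarse_wedge T)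
    (coarse_wedge_subbase : set (set T)) id.

HB.mixin Record isCompact T & Topological T := {
  compact_setT : compact [set: T]
}.

#[short(type="compactType")]
HB.structure Definition Compact := {T of Topological T & isCompact T}.

Section CoarseWedgeCompact.
Context {d : Order.disp_t} {T : rootedChainCompleteTreeType d}.
Implicit Types s t u : T.

Lemma tree_comparable u s t : (s <= u -> t <= u -> s <= t \/ t <= s)%O.
Proof.
rewrite !le_eqVlt => /predU1P[->|su] /predU1P[->|tu].
- by left; rewrite eqxx.
- by right; rewrite tu orbT.
- by left; rewrite su orbT.
have [||z [[zst zmin] _]] := @tree_wo_chain d T u [pred x | (x == s) || (x == t)].
- by move=> x /= /orP[] /eqP ->.
- by exists s; rewrite inE eqxx.
move: zst; rewrite inE => /orP[] /eqP zE; rewrite zE in zmin.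
- by left; rewrite -le_eqVlt; apply: zmin; rewrite inE eqxx orbT.
- by right; rewrite -le_eqVlt; apply: zmin; rewrite inE eqxx.
Qed.

Lemma successor_level_pred t : successor_level t ->
  exists2 p, (p < t)%O & forall s, (s < t)%O -> (s <= p)%O.
Proof.
move=> [W [R [_ [f [g fK gK] fmono]]]].
exists (sval (g None)); first exact: svalP (g None).
move=> s st; have := fmono (exist _ s st) (g None).
by rewrite gK /succ_rel /below_rel /=; case: (f _) => [?|] <-.
Qed.

Lemma minimal_le t u : wochoice.minimal <=%O t -> (t <= u)%O.
Proof.
move=> tmin; have [m [/(_ _) mub mlb]] :=
  @tree_chain_complete d T set0 (fun s t (h : set0 s) _ => match h with end).
have mu v : (m <= v)%O by apply: mlb => x [].
exact: le_trans (tmin _ (mu t)) (mu u).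
Qed.

Lemma coarse_wedge_compact : compact [set: coarse_wedge T].
Proof.
rewrite compact_ultra => F UF _.
pose A : set T := [set s | coarse_wedge_index s /\ F (upset s)].
have Achain : total_on A <=%O.
  move=> s t [_ Fs] [_ Ft].
  have /filter_ex[u [/= su tu]] : F (upset s `&` upset t) by exact: filterI.
  exact: tree_comparable su tu.
have [p [Aub Alub]] := tree_chain_complete _ Achain.
exists p; split => //.
have subbase_p (U : set T) : coarse_wedge_subbase U -> U p -> F U.
  move=> [t tI [->|->]].
    rewrite /upset/= => tp; have [//|/= Ft] := in_ultra_setVsetC (upset t) UF.
    case: tI => [tmin|tsucc].
      apply: filterS (filterT : F setT) => u _; exact: minimal_le.
    have [q qt qmax] := successor_level_pred tsucc.
    suff : (p <= q)%O.
      by move=> /(le_lt_trans)/(_ qt)/(le_lt_trans tp); rewrite ltxx.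
    apply: Alub => a Aa; apply: qmax.
    have [ta|at_] := tree_comparable tp (Aub _ Aa).
      exfalso; have /filter_ex[u [/= nt au]] : F ((~` upset t) `&` upset a).
        by apply: filterI => //; case: Aa.
      by apply: nt; exact: le_trans ta au.
    rewrite lt_neqAle at_ andbT; apply/eqP => aE; subst a.
    have /filter_ex[u [/= nt au]] : F ((~` upset t) `&` upset t).
        by apply: filterI => //; case: Aa.
    exact: nt.
  move=> /= ntp; have [/= Ft|//] := in_ultra_setVsetC (upset t) UF.
  by exfalso; apply: ntp; apply: Aub; split.
move=> B; rewrite nbhsE => -[U [Uop Up] UB]; apply: filterS UB _.
move: Uop => [D DI UE]; rewrite -UE in Up *.
case: Up => V DV Vp.
apply: (@filterS _ F _ V); first by move=> x Vx; exists V.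
have [N NI VE] := DI _ DV; rewrite -VE in Vp *.
apply: filter_bigI => i iN; apply: subbase_p; last exact: Vp.
by have := NI _ iN; rewrite inE.
Qed.

HB.instance Definition _ :=
  isCompact.Build (coarse_wedge T) coarse_wedge_compact.

End CoarseWedgeCompact.

(* Scalar fields for which the norm, valued in [K] as usual in MathComp, has
   suprema: both [R] and [R[i]] are instances. In [R[i]] the order relates
   numbers with equal imaginary parts, so that [supremum] applied to a bounded
   set of absolute values is their real supremum. *)
HB.mixin Record isScalarField K & Num.NumField K := {
  scalar_has_sup : forall A : set K, has_sup A -> supremums A !=set0;
  scalar_complete : forall F : set_system K^o,
    ProperFilter F -> cauchy F -> cvg F
}.

#[short(type="scalarFieldType")]
HB.structure Definition ScalarField :=
  {K of Num.NumField K & isScalarField K}.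

Lemma real_has_sup (R : realType) (A : set R) : has_sup A -> supremums A !=set0.
Proof.
move=> hA; exists (sup A); split; first by move=> x; apply: sup_upper_bound.
by move=> y yub; apply: ge_sup => //; case: hA.
Qed.

HB.instance Definition _ (R : realType) :=
  isScalarField.Build R (@real_has_sup R) (@R_complete R).

Section ComplexScalar.
Variable R : realType.

Local Notation Re := (@complex.Re R).
Local Notation Im := (@complex.Im R).

Lemma complex_has_sup (A : set R[i]) : has_sup A -> supremums A !=set0.
Proof.
move=> [[a Aa] [u uA]].
have ImA x : A x -> Im x = Im u.
  by move=> /uA; rewrite lecE => /andP[/eqP ->].
have hsup : has_sup (Re @` A).
  split; first by exists (Re a), a.
  by exists (Re u) => _ [x /uA + <-]; rewrite lecE => /andP[].
exists (Complex (sup (Re @` A)) (Im u)); split.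
  move=> x Ax; rewrite lecE /= (ImA _ Ax) eqxx /=.
  by apply: sup_upper_bound => //; exists x.
move=> y yub; rewrite lecE /=.
have := yub _ Aa; rewrite lecE => /andP[/eqP -> _].
rewrite (ImA _ Aa) eqxx /=; apply: ge_sup; first by case: hsup.
by move=> _ [x /yub + <-]; rewrite lecE => /andP[].
Qed.

Lemma complex_complete (F : set_system R[i]^o) :
  ProperFilter F -> cauchy F -> cvg F.
Proof.
move=> FF /cauchy_ballP Fc.
have key (g : R[i] -> R) : (forall x y, g (x - y) = g x - g y) ->
    (forall x, `|g x|%:C%C <= `|x|) -> cvg (g @ F).
  move=> gB gle; apply: R_complete; apply/cauchy_ballP => e e0.
  have e0C : 0 < e%:C%C :> R[i] by rewrite ltcR.
  have [[/= P Q] [FP FQ] PQ] := Fc _ e0C.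
  exists (g @` P, g @` Q) => /=.
    by split; [apply: filterS FP|apply: filterS FQ] => x Px; exists x.
  move=> [_ _] /= [[x Px <-] [y Qy <-]]; rewrite /ball /= -gB -ltcR.
  apply: le_lt_trans (gle _) _.
  exact: (PQ (x, y) (conj Px Qy)).
have /cvg_ex[a /= Ha] : cvg (Re @ F).
  apply: key; first by move=> [? ?] [? ?].
  exact: normc_ge_Re.
have /cvg_ex[b /= Hb] : cvg (Im @ F).
  apply: key; first by move=> [? ?] [? ?].
  by move=> x; rewrite normc_def lecR -sqrtr_sqr ler_wsqrtr // lerDr sqr_ge0.
apply/cvg_ex; exists (Complex a b : R[i]^o).
apply/cvgrPdist_le => e e0.
have eE : e = (Re e)%:C%C.
  by move: e0; rewrite ltcE /= => /andP[/eqP]; case: e => ? ? /= ->.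
have e20 : 0 < Re e / 2 by rewrite divr_gt0 // -ltcR -eE.
have Fa := @cvgr_dist_le _ _ _ _ _ _ _ Ha _ e20.
have Fb := @cvgr_dist_le _ _ _ _ _ _ _ Hb _ e20.
have FF' : Filter F := FF.
apply: filterS2 (Fa FF') (Fb FF') => z za zb.
have -> : ((a +i* b)%C : R[i]^o) - z =
    (a - Re z)%:C%C + 'i%C * (b - Im z)%:C%C.
  by rewrite [LHS]complexE; case: z {za zb}.
apply: le_trans (ler_normD _ _) _.
rewrite normrM complexiE normCi mul1r.
rewrite !normc_def/= !expr0n/= !addr0 !sqrtr_sqr.
by rewrite -rmorphD /= eE lecR [leRHS]splitr lerD.
Qed.

HB.instance Definition _ :=
  isScalarField.Build R[i] complex_has_sup complex_complete.

End ComplexScalar.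

Section SupremumTheory.
Variable K : scalarFieldType.
Implicit Types A : set K.

Lemma supremum_ub A x : has_sup A -> A x -> x <= supremum 0 A.
Proof.
move=> /scalar_has_sup[m mA] Ax.
rewrite /supremum; case: ifPn => [/eqP AE|_]; first by rewrite AE in Ax.
by case: xgetP => [z -> [zub _]|/(_ m)//]; exact: zub.
Qed.

Lemma supremum_le_ub A y : A !=set0 -> ubound A y -> supremum 0 A <= y.
Proof.
move=> A0 yub; have [m mA] := @scalar_has_sup K A (conj A0 (ex_intro _ y yub)).
rewrite /supremum; case: ifPn => [/eqP AE|_]; first by case: A0 => z; rewrite AE.
by case: xgetP => [z -> [_ zlb]|/(_ m)//]; exact: zlb.
Qed.
End SupremumTheory.

Definition cfun (T : compactType) (K : scalarFieldType) : Type :=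
  continuousType T K^o.

Section ContinuousFunctions.
Variables (T : compactType) (K : scalarFieldType).
Implicit Types (f g h : (cfun T K)) (a : K).

HB.instance Definition _ := Choice.on (cfun T K).

Lemma cfun_ct f : continuous (f : T -> K^o).
Proof. exact: cts_fun. Qed.

Lemma cfunP f g : (f : T -> K^o) =1 g -> f = g.
Proof. by move/continuousEP. Qed.

Fact cfun0_ct : continuous (fun _ : T => 0 : K^o).
Proof. by move=> x; exact: cvg_cst. Qed.
Fact cfunN_ct f : continuous (fun t => - (f : T -> K^o) t).
Proof. by move=> x; apply: cvgN; exact: cfun_ct. Qed.
Fact cfunD_ct f g : continuous (fun t => (f : T -> K^o) t + (g : T -> K^o) t).
Proof. by move=> x; apply: cvgD; exact: cfun_ct. Qed.
Fact cfunZ_ct a f : continuous (fun t => a *: (f : T -> K^o) t).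
Proof. by move=> x; apply: cvgZr; exact: cfun_ct. Qed.

Definition cfun0 : (cfun T K) := mkcts cfun0_ct.
Definition cfunN f : (cfun T K) := mkcts (@cfunN_ct f).
Definition cfunD f g : (cfun T K) := mkcts (@cfunD_ct f g).
Definition cfunZ a f : (cfun T K) := mkcts (@cfunZ_ct a f).

Fact cfunDA : associative cfunD.
Proof. by move=> f g h; apply: cfunP => t; exact: addrA. Qed.
Fact cfunDC : commutative cfunD.
Proof. by move=> f g; apply: cfunP => t; exact: addrC. Qed.
Fact cfun0D : left_id cfun0 cfunD.
Proof. by move=> f; apply: cfunP => t; exact: add0r. Qed.
Fact cfunND : left_inverse cfun0 cfunN cfunD.
Proof. by move=> f; apply: cfunP => t; exact: addNr. Qed.

HB.instance Definition _ :=
  GRing.isZmodule.Build (cfun T K) cfunDA cfunDC cfun0D cfunND.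

Fact cfunZA a b f : cfunZ a (cfunZ b f) = cfunZ (a * b) f.
Proof. by apply: cfunP => t; exact: scalerA. Qed.
Fact cfun1Z : left_id 1 cfunZ.
Proof. by move=> f; apply: cfunP => t; exact: scale1r. Qed.
Fact cfunZDr : right_distributive cfunZ +%R.
Proof. by move=> a f g; apply: cfunP => t; exact: scalerDr. Qed.
Fact cfunZDl f : {morph cfunZ^~ f : a b / a + b}.
Proof. by move=> a b; apply: cfunP => t; exact: scalerDl. Qed.

HB.instance Definition _ :=
  GRing.Zmodule_isLmodule.Build K (cfun T K) cfunZA cfun1Z cfunZDr cfunZDl.

Definition cfun_norm f : K := supremum 0 [set `|(f : T -> K^o) t| | t in [set: T]].

Lemma cfun_bounded f : exists M : K, forall t, `|(f : T -> K^o) t| <= M.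
Proof.
have /compact_near_coveringP cT := @compact_setT T.
have : \forall M \near +oo_K, [set: T] `<=` (fun t => `|(f : T -> K^o) t| <= M).
  apply: (cT _ _ (fun M t => `|(f : T -> K^o) t| <= M)) => t _.
  exists ([set u | `|(f : T -> K^o) u| <= `|(f : T -> K^o) t| + 1],
          [set M | `|(f : T -> K^o) t| + 1 <= M]) => /=.
    split; last by apply: nbhs_pinfty_ge; rewrite realD.
    by apply: cvgr_norm_le (@cfun_ct f t) _ _; rewrite ltrDl.
  by move=> [u M] /= [fu fM]; exact: le_trans fu fM.
by move=> /filter_ex[M fM]; exists M => t; exact: fM.
Qed.

Lemma cfun_norm_ub f t : `|(f : T -> K^o) t| <= cfun_norm f.
Proof.
apply: supremum_ub; last by exists t.
have [M fM] := cfun_bounded f.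
by split; [exists `|(f : T -> K^o) t|, t|exists M => _ [u _ <-]].
Qed.

Lemma cfun_norm_le f (M : K) : 0 <= M ->
  (forall t, `|(f : T -> K^o) t| <= M) -> cfun_norm f <= M.
Proof.
move=> M0 fM; rewrite /cfun_norm.
have [->|/set0P A0] := eqVneq [set `|(f : T -> K^o) t| | t in [set: T]] set0.
  by rewrite supremum0.
by apply: supremum_le_ub => // _ [t _ <-].
Qed.

Lemma cfun_norm_ge0 f : 0 <= cfun_norm f.
Proof.
rewrite /cfun_norm.
have [->|/set0P[_ [t _ _]]] := eqVneq [set `|(f : T -> K^o) t| | t in [set: T]] set0.
  by rewrite supremum0.
exact: le_trans (normr_ge0 _) (cfun_norm_ub f t).
Qed.

Fact cfun_normD f g : cfun_norm (f + g) <= cfun_norm f + cfun_norm g.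
Proof.
apply: cfun_norm_le; first by rewrite addr_ge0 ?cfun_norm_ge0.
by move=> t; rewrite (le_trans (ler_normD _ _))// lerD ?cfun_norm_ub.
Qed.

Fact cfun_normZ_le a f : cfun_norm (a *: f) <= `|a| * cfun_norm f.
Proof.
apply: cfun_norm_le; first by rewrite mulr_ge0 ?cfun_norm_ge0.
by move=> t; rewrite normrM ler_wpM2l ?cfun_norm_ub.
Qed.

Fact cfun_normZ a f : cfun_norm (a *: f) = `|a| * cfun_norm f.
Proof.
apply/le_anti; rewrite cfun_normZ_le /=.
have [->|a0] := eqVneq a 0; first by rewrite normr0 mul0r cfun_norm_ge0.
rewrite -ler_pdivlMl ?normr_gt0// -normfV.
by have := cfun_normZ_le a^-1 (a *: f); rewrite scalerA mulVf// scale1r.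
Qed.

Fact cfun_norm0_eq0 f : cfun_norm f = 0 -> f = 0.
Proof.
move=> f0; apply: cfunP => t; apply/eqP; rewrite -normr_le0 -f0.
exact: cfun_norm_ub.
Qed.

HB.instance Definition _ := Lmodule_isNormed.Build K (cfun T K)
  cfun_normD cfun_normZ cfun_norm0_eq0.

Fact cfun_complete (F : set_system (cfun T K)) :
  ProperFilter F -> cauchy F -> cvg F.
Proof.
move=> FF /cauchy_ballP Fc.
have evc t : cvg ((fun f : (cfun T K) => (f : T -> K^o) t) @ F).
  apply: scalar_complete; apply/cauchy_ballP => e e0.
  have [[/= P Q] [FP FQ] PQ] := Fc _ e0.
  exists ((fun f : (cfun T K) => (f : T -> K^o) t) @` P,
          (fun f : (cfun T K) => (f : T -> K^o) t) @` Q) => /=.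
    by split; [apply: filterS FP|apply: filterS FQ] => x Px; exists x.
  move=> [_ _] /= [[f Pf <-] [g Qg <-]]; rewrite /ball /=.
  have := PQ (f, g) (conj Pf Qg); rewrite -ball_normE /= => fg.
  exact: le_lt_trans (cfun_norm_ub (f - g) t) fg.
pose l t : K^o := lim ((fun f : (cfun T K) => (f : T -> K^o) t) @ F).
have lP e : 0 < e ->
    F [set f : cfun T K | forall t, `|l t - (f : T -> K^o) t| <= e].
  move=> e0; have e20 : 0 < e / 2 by rewrite divr_gt0.
  have [[/= P Q] [FP FQ] PQ] := Fc _ e20.
  apply: filterS FP => f Pf t.
  have Fl : F [set f : cfun T K | `|l t - (f : T -> K^o) t| <= e / 2].
    exact: (@cvgr_dist_le _ _ _ _ _ _ _ (evc t) _ e20).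
  have /filter_ex[g [Qg /= gl]] :
      F (Q `&` [set h : cfun T K | `|l t - (h : T -> K^o) t| <= e / 2]).
    exact: (@filterI _ F _).
  have := PQ (f, g) (conj Pf Qg); rewrite -ball_normE /= => /ltW fg.
  have fgt := le_trans (cfun_norm_ub (f - g) t) fg.
  rewrite -(subrKA ((g : T -> K^o) t)) (le_trans (ler_normD _ _))//.
  by rewrite [leRHS]splitr lerD // distrC.
have lct : continuous l.
  move=> t; apply/cvgrPdist_le => e e0.
  have e30 : 0 < e / 3 by rewrite divr_gt0.
  have /filter_ex[f fl] := lP _ e30.
  have /cvgrPdist_le/(_ _ e30) := @cfun_ct f t.
  apply: filterS => u fu.
  rewrite -(subrKA ((f : T -> K^o) t)) (le_trans (ler_normD _ _))//.
  rewrite (_ : e = e / 3 + (e / 3 + e / 3)); last first.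
    by rewrite -[e / 3 + e / 3]mulr2n -mulrS -[RHS]mulr_natr divfK// pnatr_eq0.
  rewrite lerD //.
  rewrite -(subrKA ((f : T -> K^o) u)) (le_trans (ler_normD _ _))//.
  by rewrite lerD // distrC.
apply/cvg_ex; exists (mkcts lct : (cfun T K)).
apply/cvgrPdist_le => e e0; apply: filterS (lP _ e0) => f fl.
by apply: cfun_norm_le; [exact: ltW|exact: fl].
Qed.

HB.instance Definition _ := Uniform_isComplete.Build (cfun T K) cfun_complete.

End ContinuousFunctions.
Section Plichko.
Variables (K : scalarFieldType) (X : completeNormedModType K).
Implicit Types (f : {linear X -> K^o}) (S : set {linear X -> K^o}) (M : set X).

Definition dual : set {linear X -> K^o} := [set f | continuous f].

Definition dual_norm f : K := supremum 0 [set `|f x| | x in [set x | `|x| <= 1]].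

Definition dual_unit_ball : set {linear X -> K^o} :=
  [set f | dual f /\ dual_norm f <= 1].

(* The supremum is over a set bounded by [`|x|]; it is [0] if the set is empty. *)
Definition norming (lambda : K) S : Prop :=
  forall x : X,
    `|x| <= lambda * supremum 0 [set `|f x| | f in S `&` dual_unit_ball].

Definition linear_span M : set X :=
  [set x | exists (n : nat) (a : 'I_n -> K) (m : 'I_n -> X),
     (forall i, M (m i)) /\ x = \sum_(i < n) a i *: m i].

Definition sigma_subspace S : Prop :=
  exists2 M, closure (linear_span M) = [set: X] &
    S = [set f | dual f /\ countable [set m | M m /\ f m != 0]].

Definition plichko (lambda : K) : Prop :=
  exists2 S, norming lambda S & sigma_subspace S.

End Plichko.

Section Valdivia.
Variable R : realType.

Definition homeo_embedding (X Y : topologicalType) (h : X -> Y) : Prop :=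
  [/\ injective h, continuous h &
      forall U, open U -> exists2 V, open V & h @` U = range h `&` V].

Definition Sigma (Gamma : Type) : set {ptws Gamma -> R} :=
  [set x | countable [set g | x g != 0]].

Definition sigma_subset (X : compactType) (A : set X) : Prop :=
  exists (Gamma : Type) (h : X -> {ptws Gamma -> R}),
    homeo_embedding h /\ h @` A = range h `&` @Sigma Gamma.

Definition valdivia (X : compactType) : Prop :=
  exists2 A : set X, sigma_subset A & dense A.

End Valdivia.

(* Main.v *)
From HB Require Import structures.
Require Import Defs.
From mathcomp Require Import all_boot all_order all_algebra.
From mathcomp Require Import all_classical all_reals all_analysis.
From mathcomp Require Import complex.

Set Implicit Arguments.
Unset Strict Implicit.
Unset Printing Implicit Defensive.

Import Order.TTheory GRing.Theory Num.Theory.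
Import numFieldNormedType.Exports.

Local Open Scope classical_set_scope.
Local Open Scope ring_scope.

(** Both properties are compared with a third one: the existence of a family of
    clopen sets that separates the points of the tree and such that the points
    lying in only countably many of its members are dense.

    If a compact space with a base of clopen sets is Valdivia, embedded by [h]
    in a power of the real line, then for each coordinate, each sign and each
    pair of rationals 0 < q < r a clopen set fits between the closed set where
    the signed coordinate is at least r and the open set where it exceeds q;
    these sets form such a family ([valdivia_clopen_family]).  Conversely, given
    such a family in a compact space, the indicators of the finite
    intersections of its members span a dense subspace of the continuous
    functions, by a Boolean version of the Stone-Weierstrass theorem
    ([span_dense]).  The evaluation at a point lying in countably many members
    kills all but countably many of these indicators, hence belongs to the
    Sigma-subspace they define, and as such points are dense, the evaluations at
    them are 1-norming ([family_plichko]).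

    In the other direction, let [M] and [S] witness that the space is 1-Plichko.
    The point is that the evaluation at every point [s] that is minimal or on a
    successor level belongs to [S] ([countable_support_index]), although [s]
    need not be a G_delta point.  For a finite set F of immediate successors of
    [s], let U be the wedge of [s] deprived of the wedges of the members of F.
    As [S] is 1-norming, it contains a functional of norm at most one whose
    value on the indicator of U is almost 1 in modulus, so that it has almost no
    mass outside U.  It can charge only few of the remaining wedges, and F is
    enlarged by those.  Iterating, one gets a sequence of functionals in [S]
    that asymptotically have no mass off the wedge of [s] and no mass on the
    wedge of any immediate successor of [s].  Now a continuous function is
    almost constant on some U as above, so any function killed by the whole
    sequence vanishes at [s]; and all but countably many elements of [M] are
    killed by the whole sequence.  The points [s] of this kind are dense
    ([index_dense]), and evaluation on [M] is the required embedding
    ([plichko_valdivia]). *)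

(** * Compactness and the coarse wedge topology *)

(** Compactness as an induction principle.  If it failed, the complements of the
    sets satisfying [Q] would generate a proper filter on [E] without cluster
    point. *)
Lemma compact_ind (X : topologicalType) (E : set X) (Q : set X -> Prop) :
  compact E -> Q set0 -> (forall A B, Q A -> Q B -> Q (A `|` B)) ->
  (forall x, E x -> exists2 U, nbhs x U & Q U) ->
  exists2 C, E `<=` C & Q C.
Proof.
move=> cE Q0 QU Qloc; apply: contrapT => noC.
pose F : set_system X := [set A | exists2 U, Q U & E `\` U `<=` A].
have FF : ProperFilter F.
  apply: Build_ProperFilter_ex.
    move=> A [U QU' EUA]; apply: contrapT => A0; apply: noC; exists U => // x Ex.
    by apply: contrapT => Ux; apply: A0; exists x; exact: EUA.
  split; first by exists set0.
    move=> A B [U QU' EUA] [V QV EVB]; exists (U `|` V); first exact: QU.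
    move=> x [Ex nUV]; split; first by apply: EUA; split=> // Ux; apply: nUV; left.
    by apply: EVB; split=> // Vx; apply: nUV; right.
  by move=> A B AB [U QU' EUA]; exists U => //; exact: subset_trans AB.
have FE : F E by exists set0 => // x [].
have [x [Ex clx]] := cE F FF FE.
have [U Ux QU'] := Qloc x Ex.
have FU : F (~` U) by exists U => // y [].
by have [y []] := clx _ _ FU Ux.
Qed.

Section Tree.
Context {d : Order.disp_t} {T : rootedChainCompleteTreeType d}.
Implicit Types s t u w x y z : T.

Lemma tree_wf_below x (P : T -> Prop) y : (y < x)%O -> P y ->
  exists z, [/\ (z < x)%O, P z & forall w, (w < x)%O -> P w -> (z <= w)%O].
Proof.
move=> yx Py.
have [|| z [[zin zmin] _]] :=
    @tree_wo_chain d T x [pred w | (w < x)%O && `[< P w >]].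
- by move=> w /andP[].
- by exists y; rewrite inE yx; exact/asboolP.
move: zin; rewrite inE => /andP[zx /asboolP Pz]; exists z; split => // w wx Pw.
by apply: zmin; rewrite inE wx; exact/asboolP.
Qed.

(** Order types need not be handled explicitly: a point is on a successor level
    as soon as its predecessors have a maximum [p], since dropping [p] leaves
    the well-order of the predecessors of [p]. *)
Lemma successor_level_of_pred p t : (p < t)%O ->
  (forall s, (s < t)%O -> (s <= p)%O) -> successor_level t.
Proof.
move=> pt pmax.
exists {s : T | (s < p)%O}, (@below_rel d T p); split.
  move=> A [a Aa].
  pose P w := exists h : (w < p)%O, exist _ w h \in A.
  have [z [zp [zp' Az] zmin]] : exists z, [/\ (z < p)%O, P z &
      forall w, (w < p)%O -> P w -> (z <= w)%O].
    apply: (@tree_wf_below p P (sval a)); first exact: svalP a.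
    by case: a Aa => a ap Aa; exists ap.
  exists (exist _ z zp'); split.
    split => // -[w wp] Aw; rewrite /below_rel/=; apply: zmin => //.
    by exists wp.
  move=> [w wp] [Aw wmin]; apply: val_inj => /=.
  apply/le_anti/andP; split; first by apply: zmin => //; exists wp.
  exact: wmin _ Az.
pose f (x : {s : T | (s < t)%O}) : option {s : T | (s < p)%O} :=
  insub (sval x).
pose g (y : option {s : T | (s < p)%O}) : {s : T | (s < t)%O} :=
  if y is Some z then exist _ (sval z) (lt_trans (svalP z) pt)
  else exist _ p pt.
exists f.
  exists g.
    move=> [x xt]; apply: val_inj; rewrite /f /=.
    case: insubP => [u up uE|]; first by rewrite /= -uE.
    by have := pmax _ xt; rewrite le_eqVlt => /orP[/eqP ->//|->].
  case=> [[z zp]|] /=; rewrite /f /=; last by rewrite insubN // ltxx.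
  by rewrite insubT.
have pmax_eq z : (z < t)%O -> ~~ (z < p)%O -> z = p.
  by move=> /pmax; rewrite le_eqVlt => /orP[/eqP//|->].
move=> [x xt] [y yt]; rewrite /f /below_rel /=.
case: insubP => [u /= xp uE|nxp]; case: insubP => [v /= yp vE|nyp] /=.
- by rewrite uE vE.
- rewrite (pmax_eq _ yt nyp); exact/esym/ltW.
- by rewrite (pmax_eq _ xt nxp) lt_geF.
- by rewrite (pmax_eq _ yt nyp) (pmax_eq _ xt nxp) lexx.
Qed.

(** The least point [t] below [x] that is not below [y] must be on a successor
    level: the predecessors of [t] are all below [y], so their supremum is below
    [y], hence differs from [t], and is therefore their maximum. *)
Lemma index_separates x y : ~~ (x <= y)%O ->
  exists2 t, coarse_wedge_index t & (t <= x)%O && ~~ (t <= y)%O.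
Proof.
move=> nxy.
have [t [tx nty tmin]] : exists t, [/\ (t <= x)%O, ~~ (t <= y)%O &
    forall w, (w < t)%O -> (w <= y)%O].
  have [[z zx nzy]|no] := pselect (exists2 z, (z < x)%O & ~~ (z <= y)%O).
    have [t [tx nty tmin]] := @tree_wf_below x (fun w => ~~ (w <= y)%O) z zx nzy.
    exists t; split => //; first exact: ltW.
    move=> w wt; apply: contraT => nwy.
    by have := tmin _ (lt_trans wt tx) nwy; rewrite (lt_geF wt).
  exists x; split => // w wx; apply: contraT => nwy.
  by exfalso; apply: no; exists w.
exists t; last by rewrite tx.
right; have [|m [mub mlub]] := @tree_chain_complete d T [set s | (s < t)%O].
  by move=> u v /= /ltW ut /ltW vt; exact: tree_comparable ut vt.
have mt : (m <= t)%O by apply: mlub => s /ltW.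
have my : (m <= y)%O by apply: mlub => s; exact: tmin.
apply: (@successor_level_of_pred m) => //.
rewrite lt_neqAle mt andbT; apply/eqP => mE; move: nty.
by rewrite -mE my.
Qed.

Definition immediate_successors s : set T :=
  [set w | (s < w)%O /\ forall z, (z < w)%O -> (z <= s)%O].

Lemma immediate_successor_le s t : (s < t)%O ->
  exists2 w, immediate_successors s w & (w <= t)%O.
Proof.
move=> st.
have [[z /andP[sz zt]]|no] := pselect (exists z, (s < z < t)%O); last first.
  exists t => //; split => // z zt.
  have [|//] := tree_comparable (ltW st) (ltW zt).
  by rewrite le_eqVlt => /orP[/eqP ->//|sz]; exfalso; apply: no; exists z; rewrite sz.
have [w [wt sw wmin]] := @tree_wf_below t (fun w => (s < w)%O) z zt sz.
exists w; last exact: ltW.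
split => // v vw; have vt := lt_trans vw wt.
have [|//] := tree_comparable (ltW st) (ltW vt).
rewrite le_eqVlt => /orP[/eqP ->//|sv].
by have := wmin _ vt sv; rewrite (lt_geF vw).
Qed.

Lemma immediate_successor_index s w :
  immediate_successors s w -> coarse_wedge_index w.
Proof. by move=> [sw wmin]; right; exact: successor_level_of_pred sw wmin. Qed.

Lemma immediate_successors_disjoint s v w x :
  immediate_successors s v -> immediate_successors s w ->
  (v <= x)%O -> (w <= x)%O -> v = w.
Proof.
have key a b : immediate_successors s a -> immediate_successors s b ->
    (a <= b)%O -> a = b.
  move=> [sa _] [_ bmax]; rewrite le_eqVlt => /orP[/eqP//|/bmax].
  by rewrite (lt_geF sa).
move=> sv sw vx wx; have [vw|wv] := tree_comparable vx wx; first exact: key.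
by apply/esym; exact: key.
Qed.

End Tree.

Section Topology.
Context {d : Order.disp_t} {T : rootedChainCompleteTreeType d}.
Implicit Types s t w x y : T.

Lemma subbase_open (U : set (coarse_wedge T)) :
  coarse_wedge_subbase (U : set T) -> open U.
Proof.
move=> bU; exists [set U]; last by rewrite bigcup_set1.
by move=> _ ->; exact: (@finI_from1 _ _ (coarse_wedge_subbase : set (set T)) id).
Qed.

Lemma upset_clopen t : coarse_wedge_index t ->
  clopen (upset t : set (coarse_wedge T)).
Proof.
move=> It; split; first by apply: subbase_open; exists t => //; left.
by rewrite -openC; apply: subbase_open; exists t => //; right.
Qed.

(** Stating with filters that the subbase determines the neighbourhoods turns
    each of the local bases below into the verification of two cases. *)
Lemma wedge_filter_cvg (x : coarse_wedge T) (F : set_system (coarse_wedge T)) :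
  Filter F ->
  (forall t, coarse_wedge_index t -> (t <= x)%O -> F (upset t)) ->
  (forall t, coarse_wedge_index t -> ~~ (t <= x)%O -> F (~` upset t)) ->
  F --> x.
Proof.
move=> FF Fin Fout N; rewrite nbhs_filterE nbhsE => -[_ [[D DI <-] [V DV Vx]] ON].
apply: filterS ON _; apply: (@filterS _ F _ V); first by move=> y Vy; exists V.
have [L LI VE] := DI _ DV; rewrite -VE in Vx *.
apply: filter_bigI => i iL.
have := Vx i iL; have := LI _ iL; rewrite inE => -[t It [->|->]] /= tx.
  exact: Fin.
by apply: Fout => //; exact/negP.
Qed.

Lemma clopen_base (x : coarse_wedge T) (N : set (coarse_wedge T)) :
  nbhs x N -> exists2 U, clopen U /\ U x & U `<=` N.
Proof.
apply: (@wedge_filter_cvg x (filter_from [set U | clopen U /\ U x] id)).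
- apply: filter_from_filter; first by exists setT; split=> //; exact: clopenT.
  move=> A B [cA Ax] [cB Bx]; exists (A `&` B) => //.
  by split => //; exact: clopenI.
- by move=> t It tx; exists (upset t) => //; split => //; exact: upset_clopen.
- move=> t It ntx; exists (~` upset t) => //; split; last exact/negP.
  by apply: (clopenC set0); exact: upset_clopen.
Qed.

Definition pruned_wedge (s : T) (L : seq T) : set (coarse_wedge T) :=
  [set x : T | (s <= x)%O /\ forall w, w \in L -> ~~ (w <= x)%O].

Lemma pruned_wedge_clopen s (L : seq T) : coarse_wedge_index s ->
  {in L, forall w, immediate_successors s w} ->
  clopen (pruned_wedge s L).
Proof.
move=> Is; elim: L => [|w L IH] LI.
  rewrite (_ : pruned_wedge s [::] = upset s); first exact: upset_clopen.
  by apply/seteqP; split => x; [case|split].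
rewrite (_ : pruned_wedge s (w :: L) = pruned_wedge s L `&` ~` upset w).
  apply: clopenI; first by apply: IH => v vL; apply: LI; rewrite inE vL orbT.
  apply: (clopenC set0); apply: upset_clopen; apply: immediate_successor_index.
  by apply: LI; rewrite inE eqxx.
apply/seteqP; split => x.
  move=> [sx nL]; split; last by apply/negP; apply: nL; rewrite inE eqxx.
  by split => // v vL; apply: nL; rewrite inE vL orbT.
move=> [[sx nL] /negP nw]; split => // v; rewrite inE => /orP[/eqP ->//|].
exact: nL.
Qed.

Lemma pruned_wedge_self s (L : seq T) :
  {in L, forall w, immediate_successors s w} -> pruned_wedge s L s.
Proof. by move=> LI; split => // w /LI[sw _]; rewrite (lt_geF sw). Qed.

(** A subbasic neighbourhood of [s] that does not contain the wedge of [s] is the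
    complement of the wedge of some [t > s], and then contains the complement of
    the wedge of the immediate successor of [s] below [t]. *)
Lemma pruned_wedge_base (s : coarse_wedge T) (N : set (coarse_wedge T)) : nbhs s N ->
  exists2 L : seq T, {in L, forall w, immediate_successors s w} & pruned_wedge s L `<=` N.
Proof.
apply: (@wedge_filter_cvg s (filter_from
  [set L : seq T | {in L, forall w, immediate_successors (s : T) w}] (pruned_wedge s))).
- apply: filter_from_filter; first by exists [::].
  move=> L L' LI LI'; exists (L ++ L').
    by move=> w; rewrite mem_cat => /orP[/LI|/LI'].
  by move=> x [sx nL]; split; split=> // w wL; apply: nL; rewrite mem_cat wL ?orbT.
- by move=> t _ ts; exists [::] => // x [sx _]; exact: le_trans ts sx.
- move=> t _ nts; have [st|nst] := boolP ((s : T) < t)%O.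
    have [w sw wt] := immediate_successor_le st.
    exists [:: w]; first by move=> v; rewrite inE => /eqP ->.
    move=> x [_ /(_ w)]; rewrite inE eqxx => /(_ erefl)/negP nwx tx.
    by apply: nwx; exact: le_trans wt tx.
  exists [::] => // x [sx _] tx.
  have [st|ts] := tree_comparable sx tx; last by rewrite ts in nts.
  by move: nst nts; rewrite lt_neqAle st andbT negbK => /eqP ->; rewrite lexx.
Qed.

(** Every neighbourhood of [x] contains an interval from [t] to [x] for some
    minimal or successor [t], and in particular that [t]. *)
Lemma index_dense : dense (coarse_wedge_index : set (coarse_wedge T)).
Proof.
move=> U [x Ux] oU.
suff [t [It tx] tU] : filter_from [set t : T | coarse_wedge_index t /\ (t <= x)%O]
    (fun t => [set y : T | (t <= y)%O /\ (y <= x)%O]) U.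
  exists t; split => //; apply: tU; split; [exact: lexx|done].
have [r [rmin _]] := @tree_rooted d T.
have rx : (r <= (x : T))%O by exact: minimal_le.
have nU : nbhs x U by exact: (open_nbhs_nbhs (conj oU Ux)).
move: U nU {Ux oU}; apply: (@wedge_filter_cvg x).
- apply: filter_from_filter; first by exists r; split => //; left.
  move=> t u [It tx] [Iu ux].
  have [tu|ut] := tree_comparable tx ux.
    exists u => // y [uy yx]; split => //; split => //; exact: le_trans tu uy.
  exists t => // y [ty yx]; split => //; split => //; exact: le_trans ut ty.
- by move=> t It tx; exists t => // y [].
- move=> t It ntx; exists r; first by split => //; left.
  by move=> y [_ yx] ty; move: ntx; rewrite (le_trans ty yx).
Qed.

End Topology.

(** * Evaluations, restrictions and functionals on spaces of continuous functions *)

(** The supremum of the natural numbers, if it existed, would remain an upper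
    bound after subtracting 1. *)
Lemma scalar_archimedean (K : scalarFieldType) (x : K) : 0 <= x ->
  exists n : nat, x < n%:R.
Proof.
move=> x0; apply: contrapT => noN.
have ubx n : n%:R <= x.
  rewrite real_leNgt ?realn ?ger0_real//; apply/negP => xn.
  by apply: noN; exists n.
have [m [mub mlub]] : supremums [set (n%:R : K) | n in [set: nat]] !=set0.
  apply: scalar_has_sup; split; first by exists 0%:R, 0%N.
  by exists x => _ [n _ <-]; exact: ubx.
suff : m <= m - 1 by rewrite lerBrDr gerDl ler10.
apply: mlub => _ [n _ <-]; rewrite lerBrDr natr1; apply: mub.
by exists n.+1.
Qed.

Lemma le_invn_eq0 (K : scalarFieldType) (x y : K) (n0 : nat) :
  0 <= x -> 0 <= y ->
  (forall n, (n0 <= n)%N -> x <= y * n.+1%:R^-1) -> x = 0.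
Proof.
move=> x0 y0 xy; apply/eqP; apply: contraT => xn0.
have xgt0 : 0 < x by rewrite lt_def xn0.
have [n yxn] := scalar_archimedean (divr_ge0 y0 x0).
have := xy (maxn n0 n) (leq_maxl _ _); rewrite ler_pdivlMr ?ltr0Sn// => le_y.
have : y < n%:R * x by rewrite -ltr_pdivrMr.
move=> /(le_lt_trans le_y); rewrite mulrC ltr_pM2r// ltr_nat ltnNge.
by rewrite leqW// leq_maxr.
Qed.

Section Evaluation.
Variables (X : compactType) (K : scalarFieldType).
Implicit Types (f g : cfun X K) (x : X) (U : set X).

Definition eval_at x f : K^o := (f : X -> K^o) x.

Fact eval_at_linear x : linear (eval_at x).
Proof. by []. Qed.

HB.instance Definition _ x :=
  GRing.isLinear.Build K (cfun X K) K^o _ (eval_at x) (@eval_at_linear x).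

Lemma eval_atD x f g : eval_at x (f + g) = eval_at x f + eval_at x g.
Proof. by []. Qed.

Lemma eval_atB x f g : eval_at x (f - g) = eval_at x f - eval_at x g.
Proof. by []. Qed.

Lemma eval_atZ x (a : K) f : eval_at x (a *: f) = a * eval_at x f.
Proof. by []. Qed.

Lemma eval_at_inj f g : (forall x, eval_at x f = eval_at x g) -> f = g.
Proof. exact: cfunP. Qed.

Lemma eval_at_le x f : `|eval_at x f| <= `|f|.
Proof. exact: cfun_norm_ub. Qed.

Lemma norm_le_eval f (C : K) : 0 <= C -> (forall x, `|eval_at x f| <= C) ->
  `|f| <= C.
Proof. exact: cfun_norm_le. Qed.

Lemma eval_at_dual x : @dual K (cfun X K) (eval_at x).
Proof.
apply: bounded_linear_continuous; apply/linear_boundedP; exists 1; split => //.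
by move=> r r1 f; apply: le_trans (eval_at_le x f) _; rewrite ler_peMl // ltW.
Qed.

Fact restrict_continuous U f : clopen U ->
  continuous (fun x => if x \in U then eval_at x f else 0).
Proof.
move=> [oU cU] x; rewrite /continuous_at; case: ifPn => xU.
  have nU : \forall y \near x, eval_at y f = if y \in U then eval_at y f else 0.
    have : nbhs x U by apply: open_nbhs_nbhs; split => //; exact: set_mem.
    by apply: filterS => y Uy; rewrite mem_set.
  exact: cvg_trans (near_eq_cvg nU) (@cfun_ct X K f x).
have nU : \forall y \near x, 0 = if y \in U then eval_at y f else 0.
  have : nbhs x (~` U).
    apply: open_nbhs_nbhs; split; first by rewrite openC.
    by move=> /mem_set; exact/negP.
  by apply: filterS => y Uy; rewrite memNset.
exact: cvg_trans (near_eq_cvg nU) (@cvg_cst _ (0 : K^o) _ (nbhs x) _).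
Qed.

(** The restriction to [U] extended by zero; it is given the value 0 when [U] is
    not clopen in order to be a total function of [U]. *)
Definition cfun_restrict U f : cfun X K :=
  if pselect (clopen U) is left cU then mkcts (@restrict_continuous U f cU) else 0.

Lemma eval_restrict U f x : clopen U ->
  eval_at x (cfun_restrict U f) = if x \in U then eval_at x f else 0.
Proof. by move=> cU; rewrite /cfun_restrict; case: pselect. Qed.

Fact cst_continuous1 : continuous (fun _ : X => 1 : K^o).
Proof. by move=> x; exact: cvg_cst. Qed.

Definition cfun1 : cfun X K := mkcts cst_continuous1.

Lemma eval_cfun1 x : eval_at x cfun1 = 1.
Proof. by []. Qed.

Definition cfun_indic U : cfun X K := cfun_restrict U cfun1.

Lemma eval_indic U x : clopen U -> eval_at x (cfun_indic U) = (x \in U)%:R.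
Proof. by move=> cU; rewrite eval_restrict//; case: (x \in U). Qed.

Lemma norm_restrict_le U f (C : K) : clopen U -> 0 <= C ->
  (forall x, U x -> `|eval_at x f| <= C) -> `|cfun_restrict U f| <= C.
Proof.
move=> cU C0 fC; apply: norm_le_eval => // x; rewrite eval_restrict//.
by case: ifPn => [/set_mem/fC//|]; rewrite normr0.
Qed.

Lemma norm_indic U : clopen U -> U !=set0 -> `|cfun_indic U| = 1.
Proof.
move=> cU [x Ux]; apply/le_anti/andP; split.
  by apply: norm_restrict_le => // y _; rewrite eval_cfun1 normr1.
by have := eval_at_le x (cfun_indic U); rewrite eval_indic// mem_set// normr1.
Qed.

End Evaluation.

Arguments eval_at : simpl never.

Section Dual.
Variables (K : scalarFieldType) (X : completeNormedModType K).
Implicit Types (mu : {linear X -> K^o}) (S : set {linear X -> K^o}).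

Lemma dual_unit_ball_le mu x : dual_unit_ball mu -> `|mu x| <= `|x|.
Proof.
move=> [cmu nmu].
have le1 y : `|y| <= 1 -> `|mu y| <= 1.
  move=> y1; apply: le_trans nmu; apply: supremum_ub; last by exists y.
  have /linear_boundedP[C [Cr muC]] := @continuous_linear_bounded _ _ _ 0 mu (cmu 0).
  split; first by exists `|mu y|, y.
  exists (`|C| + 1) => _ [z z1 <-].
  have CC : C < `|C| + 1.
    by apply: le_lt_trans (real_ler_norm Cr) _; rewrite ltrDl.
  apply: le_trans (muC _ CC z) _; rewrite ler_piMr// addr_ge0//.
have [->|x0] := eqVneq x 0; first by rewrite linear0 !normr0.
have nx0 : `|x| != 0 by rewrite normr_eq0.
have := le1 (`|x|^-1 *: x); rewrite normrZ normfV normr_id mulVf// lexx.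
move=> /(_ isT); rewrite linearZ/= normrM normfV normr_id.
by rewrite ler_pdivrMl ?normr_gt0// mulr1.
Qed.

Lemma contraction_dual_unit_ball mu :
  (forall x, `|mu x| <= `|x|) -> dual_unit_ball mu.
Proof.
move=> mu1; split.
  apply: bounded_linear_continuous; apply/linear_boundedP; exists 1; split => //.
  by move=> r r1 f; apply: le_trans (mu1 f) _; rewrite ler_peMl // ltW.
apply: supremum_le_ub; first by exists `|mu 0|, 0 => //=; rewrite normr0.
by move=> _ [x x1 <-]; exact: le_trans (mu1 x) x1.
Qed.

Lemma norming_attained S x (e : K) : norming 1 S -> `|x| = 1 -> 0 < e -> e <= 1 ->
  exists2 mu, S mu /\ dual_unit_ball mu & 1 - e < `|mu x|.
Proof.
move=> /(_ x) + x1 e0 e1; rewrite x1 mul1r => nS; apply: contrapT => noM.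
have le_e mu : S mu -> dual_unit_ball mu -> `|mu x| <= 1 - e.
  move=> Smu Bmu; rewrite real_leNgt ?normr_real ?rpredB ?gtr0_real//.
  by apply/negP => lt_e; apply: noM; exists mu.
suff : supremum 0 [set `|f x| | f in S `&` @dual_unit_ball K X] <= 1 - e.
  by move=> /(le_trans nS); rewrite lerBrDr gerDl => /(lt_le_trans e0); rewrite ltxx.
have [->|/set0P A0] := eqVneq [set `|f x| | f in S `&` @dual_unit_ball K X] set0.
  by rewrite supremum0 subr_ge0.
by apply: supremum_le_ub => // _ [mu [Smu Bmu] <-]; exact: le_e.
Qed.

End Dual.

Section DisjointSupports.
Variables (X : compactType) (K : scalarFieldType).
Variable mu : {linear cfun X K -> K^o}.
Hypothesis mu_le : forall g, `|mu g| <= `|g|.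
Implicit Types (f g : cfun X K).

Definition disjoint_support f g := forall x, eval_at x f = 0 \/ eval_at x g = 0.

(** Functionals on continuous functions add up their masses on disjoint supports,
    as their total variations do: after a rotation of [g] aligning [mu g] with
    [mu f], nothing cancels. *)
Lemma mass_add f g : disjoint_support f g -> `|f| <= 1 -> `|g| <= 1 ->
  exists c : K, `|f + c *: g| <= 1 /\ `|mu (f + c *: g)| = `|mu f| + `|mu g|.
Proof.
move=> dfg f1 g1.
have [c c1 cE] : exists2 c : K, `|c| <= 1 & `|mu f + c * mu g| = `|mu f| + `|mu g|.
  have [->|f0] := eqVneq (mu f) 0.
    by exists 1; rewrite ?normr1// mul1r add0r normr0 add0r.
  have [->|g0] := eqVneq (mu g) 0.
    by exists 0; rewrite ?normr0// mulr0 !addr0.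
  have nf0 : `|mu f| != 0 by rewrite normr_eq0.
  have ng0 : `|mu g| != 0 by rewrite normr_eq0.
  exists (`|mu g| / mu g * (mu f / `|mu f|)).
    by rewrite !normrM !normfV !normr_id divff// divff// mulr1.
  rewrite mulrAC divfK//.
  have -> : mu f + `|mu g| * (mu f / `|mu f|) =
      mu f / `|mu f| * (`|mu f| + `|mu g|).
    by rewrite mulrDr divfK// [`|mu g| * _]mulrC.
  by rewrite normrM normrM normfV normr_id divff// mul1r ger0_norm.
exists c; split; last by rewrite linearD linearZ.
apply: norm_le_eval => // x; rewrite linearD linearZ/=.
have [->|->] := dfg x; last first.
  by rewrite scaler0 addr0; exact: le_trans (eval_at_le x f) f1.
rewrite add0r normrM; apply: mulr_ile1 => //.
exact: le_trans (eval_at_le x g) g1.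
Qed.

(** A contraction that almost attains its norm on [f] has almost no mass off the
    support of [f]. *)
Lemma mass_complement f g (e : K) : disjoint_support f g -> `|f| <= 1 ->
  1 - e <= `|mu f| -> `|mu g| <= e * `|g|.
Proof.
move=> dfg f1 fe; have [->|g0] := eqVneq g 0; first by rewrite linear0 !normr0 mulr0.
have ng0 : 0 < `|g| by rewrite normr_gt0.
have unitg : `| (`|g|^-1) *: g| = 1 by rewrite normrZ normfV normr_id mulVf// gt_eqF.
have [||c [h1 hE]] := @mass_add f (`|g|^-1 *: g) _ f1 _.
- move=> x; rewrite linearZ/=; have [->|->] := dfg x; first by left.
  by right; rewrite scaler0.
- by rewrite unitg.
have := le_trans (mu_le (f + c *: (`|g|^-1 *: g))) h1.
rewrite hE -lerBrDl linearZ/= normrM normfV normr_id ler_pdivrMl// => le1.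
rewrite mulrC; apply: le_trans le1 _; rewrite ler_pM2l//.
by rewrite lerBlDr addrC -lerBlDr.
Qed.

(** A contraction has mass at most 1, so finitely many of the sets [V w] can be
    removed in such a way that the finite unions of the others, outside the
    removed ones, carry little mass.  Otherwise one could keep removing mass
    [1 / (n + 1)]; doing so [n + 2] times is impossible. *)
Lemma mass_exhaustion (I : eqType) (D : pred I) (V : I -> set X) (n : nat)
    (F : seq I) : all D F ->
  exists F' : seq I, [/\ all D F', {subset F <= F'} &
    forall (L : seq I) g, all D L ->
      (forall x, eval_at x g != 0 -> exists2 w, w \in L & V w x) ->
      (forall w x, w \in F' -> V w x -> eval_at x g = 0) ->
      `|mu g| <= n.+1%:R^-1 * `|g|].
Proof.
move=> DF; apply: contrapT => noF'.
have e0 : 0 < n.+1%:R^-1 :> K by rewrite invr_gt0 ltr0Sn.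
have bad F' : all D F' -> {subset F <= F'} -> exists L g, [/\ all D L,
      (forall x, eval_at x g != 0 -> exists2 w, w \in L & V w x),
      (forall w x, w \in F' -> V w x -> eval_at x g = 0), `|g| <= 1 &
      n.+1%:R^-1 <= `|mu g|].
  move=> DF' FF'; apply: contrapT => noLg; apply: noF'; exists F'; split => //.
  move=> L g DL gL gF'; have [->|g0] := eqVneq g 0.
    by rewrite linear0 !normr0 mulr0.
  have ng0 : 0 < `|g| by rewrite normr_gt0.
  rewrite real_leNgt ?normr_real ?realM ?gtr0_real//; apply/negP => lt_g.
  apply: noLg; exists L, (`|g|^-1 *: g); split => //.
  - move=> x; rewrite linearZ/= => gx; apply: gL; apply: contraNneq gx => ->.
    by rewrite scaler0.
  - by move=> w x wF' Vx; rewrite linearZ/= (gF' w)// scaler0.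
  - by rewrite normrZ normfV normr_id mulVf// gt_eqF.
  - rewrite linearZ/= normrM normfV normr_id ler_pdivlMl// mulrC; exact: ltW.
have grow N : exists F' g, [/\ all D F', {subset F <= F'},
    (forall x, eval_at x g != 0 -> exists2 w, w \in F' & V w x),
    `|g| <= 1 & N%:R * n.+1%:R^-1 <= `|mu g|].
  elim: N => [|N [F' [g [DF' FF' gF' g1 Ng]]]].
    exists F, 0; split => //; last by rewrite mul0r.
    - by move=> x; rewrite linear0 eqxx.
    - by rewrite normr0.
  have [L [h [DL hL hF' h1 eh]]] := bad F' DF' FF'.
  have [|c [gh1 ghE]] := @mass_add g h _ g1 h1.
    move=> x; have [->|/gF'[w wF' Vwx]] := eqVneq (eval_at x g) 0; first by left.
    by right; exact: hF' Vwx.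
  exists (F' ++ L), (g + c *: h); split => //.
  - by rewrite all_cat DF' DL.
  - by move=> w /FF' wF'; rewrite mem_cat wF'.
  - move=> x; rewrite linearD linearZ/=.
    have [->|/gF'[w wF' Vwx] _] := eqVneq (eval_at x g) 0; last first.
      by exists w => //; rewrite mem_cat wF'.
    have [->|/hL[w wL Vwx] _] := eqVneq (eval_at x h) 0.
      by rewrite scaler0 addr0 eqxx.
    by exists w => //; rewrite mem_cat wL orbT.
  - by rewrite ghE -natr1 mulrDl mul1r lerD.
have [F' [g [_ _ _ g1 Ng]]] := grow n.+2.
have := le_trans Ng (le_trans (mu_le g) g1).
by rewrite ler_pdivrMr ?ltr0Sn// mul1r ler_nat ltnn.
Qed.

End DisjointSupports.

(** * Approximating evaluations by functionals of a norming set *)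

Section DiracApproximation.
Context {d : Order.disp_t} {T : rootedChainCompleteTreeType d}.
Variable K : scalarFieldType.
Local Notation CT := (cfun (coarse_wedge T) K).
Implicit Types (f g m : CT) (mu : {linear CT -> K^o}) (s w : T) (L : seq T).

Local Notation succs s := (fun w => `[< immediate_successors s w >]).

Lemma succsP s L : all (succs s) L ->
  {in L, forall w, immediate_successors s w}.
Proof. by move=> /allP sL w /sL /asboolP. Qed.

Lemma not_pruned_wedge s L (x : coarse_wedge T) :
  upset s x -> ~ pruned_wedge s L x -> exists2 w, w \in L & upset w x.
Proof.
move=> sx nx; apply: contrapT => noL; apply: nx; split => // w wL.
by apply/negP => wx; apply: noL; exists w.
Qed.

(** The sequence of functionals concentrating at [s].  The finite set [F n.+1]
    contains, besides [F n], the immediate successors whose wedges are charged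
    too much by [mu n]; the later functionals are chosen to avoid these wedges.
    In this way the wedge of each immediate successor either is avoided from
    some rank on, or is never charged by [mu n] with more than
    [1 / (n + 1)]. *)
Lemma concentrating_functionals (S : set {linear CT -> K^o}) s :
  coarse_wedge_index s -> norming 1 S ->
  exists (mu : nat -> {linear CT -> K^o}) (F : nat -> seq T),
    [/\ forall n, S (mu n) /\ forall g, `|mu n g| <= `|g|,
        forall n, all (succs s) (F n),
        {homo F : n k / (n <= k)%N >-> {subset n <= k}},
        forall n, 1 - n.+1%:R^-1 <= `|mu n (cfun_indic K (pruned_wedge s (F n)))| &
        forall n L g, all (succs s) L ->
          (forall x : coarse_wedge T, eval_at x g != 0 -> exists2 w, w \in L & upset w x) ->
          (forall w (x : coarse_wedge T), w \in F n.+1 -> upset w x -> eval_at x g = 0) ->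
          `|mu n g| <= n.+1%:R^-1 * `|g|].
Proof.
move=> Is nS.
have step (p : nat * seq T) : exists q : {linear CT -> K^o} * seq T,
  all (succs s) p.2 ->
  [/\ S q.1 /\ (forall g, `|q.1 g| <= `|g|),
      all (succs s) q.2, {subset p.2 <= q.2},
      1 - p.1.+1%:R^-1 <= `|q.1 (cfun_indic K (pruned_wedge s p.2))| &
      forall L g, all (succs s) L ->
          (forall x : coarse_wedge T, eval_at x g != 0 -> exists2 w, w \in L & upset w x) ->
          (forall w (x : coarse_wedge T), w \in q.2 -> upset w x -> eval_at x g = 0) ->
          `|q.1 g| <= p.1.+1%:R^-1 * `|g|].
  case: p => n F /=.
  have [sF|nsF] := boolP (all (succs s) F); last first.
    exists (eval_at (s : coarse_wedge T) : {linear CT -> K^o}, [::]) => sF.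
    by case/negP: nsF.
  have cF : clopen (pruned_wedge s F).
    exact: pruned_wedge_clopen Is (succsP sF).
  have e0 : 0 < n.+1%:R^-1 :> K by rewrite invr_gt0 ltr0Sn.
  have e1 : n.+1%:R^-1 <= 1 :> K by rewrite invf_le1 ?ltr0Sn// ler1n.
  have n1 : `|cfun_indic K (pruned_wedge s F)| = 1.
    by apply: norm_indic => //; exists s; exact: pruned_wedge_self (succsP sF).
  have [mu [Smu Bmu] muF] := norming_attained nS n1 e0 e1.
  have mu1 g := dual_unit_ball_le g Bmu.
  have [F' [sF' FF' F'E]] :=
    mass_exhaustion mu1 (fun w : T => upset w : set (coarse_wedge T)) n sF.
  by exists (mu, F') => _; split => //; exact: ltW.
have [next nextP] := choice step.
pose F := fix F n := if n is k.+1 then (next (k, F k)).2 else [::].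
pose mu n := (next (n, F n)).1.
have sF n : all (succs s) (F n).
  by elim: n => //= n IH; have [] := nextP (n, F n) IH.
have FS n : {subset F n <= F n.+1}.
  by have [] := nextP (n, F n) (sF n).
exists mu, F; split => //.
- by move=> n; have [] := nextP (n, F n) (sF n).
- move=> n k /subnK <-; elim: (k - n)%N => [|j IH] w // /IH.
  by rewrite addSn; exact: FS.
- by move=> n; have [] := nextP (n, F n) (sF n).
- by move=> n; have [] := nextP (n, F n) (sF n).
Qed.

(** Up to scalar factors of modulus tending to 1, the functionals [mu n] converge
    pointwise to the evaluation at [s].  To see it on [m], let [a] be its value at
    [s] and let [L] be a finite set of immediate successors off whose wedges [m]
    is close to [a] in the wedge of [s].  With [U] the current pruned wedge, [m]
    splits into [a] times the indicator of [U], a part where [m - a] is small,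
    a part supported on the wedges of [L], and a part off [U]; the last two
    have negligible images under [mu n]. *)
Lemma eval_at_eq0 s m (mu : nat -> {linear CT -> K^o}) (F : nat -> seq T) :
  coarse_wedge_index s ->
  (forall n g, `|mu n g| <= `|g|) ->
  (forall n, all (succs s) (F n)) ->
  {homo F : n k / (n <= k)%N >-> {subset n <= k}} ->
  (forall n, 1 - n.+1%:R^-1 <= `|mu n (cfun_indic K (pruned_wedge s (F n)))|) ->
  (forall n L g, all (succs s) L ->
     (forall x : coarse_wedge T, eval_at x g != 0 -> exists2 w, w \in L & upset w x) ->
     (forall w (x : coarse_wedge T), w \in F n.+1 -> upset w x -> eval_at x g = 0) ->
     `|mu n g| <= n.+1%:R^-1 * `|g|) ->
  (forall n, mu n m = 0) -> eval_at (s : coarse_wedge T) m = 0.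
Proof.
move=> Is mu1 sF Fhomo mu_pruned mutail mum.
set a := eval_at (s : coarse_wedge T) m.
have [//|a0] := eqVneq a 0.
have na0 : 0 < `|a| by rewrite normr_gt0.
pose h := m - a *: cfun1 _ K.
have hE x : eval_at x h = eval_at x m - a.
  by rewrite eval_atB eval_atZ eval_cfun1 mulr1.
have : \forall y \near (s : coarse_wedge T), `|eval_at y h| <= `|a| / 2.
  have /cvgrPdist_le/(_ (`|a| / 2)) := @cfun_ct _ _ m (s : coarse_wedge T).
  by rewrite divr_gt0// => /(_ isT); apply: filterS => y; rewrite hE distrC.
move=> /pruned_wedge_base[L LI LD].
have sL : all (succs s) L by apply/allP => w /LI; exact: asboolT.
have cF n : clopen (pruned_wedge s (F n)).
  exact: pruned_wedge_clopen Is (succsP (sF n)).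
have cL : clopen (pruned_wedge s L) by exact: pruned_wedge_clopen.
(* Each of the finitely many elements of [L] enters the increasing sequence [F]
   at most once, so none enters at a large step. *)
have [n0 n0P] : exists n0, forall n, (n0 <= n)%N ->
    forall w, w \in L -> w \in F n.+1 -> w \in F n.
  elim: (L) => [|w L' [n0 n0P]]; first by exists 0%N.
  have [[k wk]|nw] := pselect (exists k, w \in F k).
    exists (maxn n0 k) => n; rewrite geq_max => /andP[n0n kn] v.
    rewrite inE => /orP[/eqP -> _|vL']; last exact: n0P.
    exact: Fhomo kn _ wk.
  exists n0 => n n0n v; rewrite inE => /orP[/eqP -> wn|vL']; last exact: n0P.
  by exfalso; apply: nw; exists n.+1.
have split_m n : m = a *: cfun_indic K (pruned_wedge s (F n))
    + cfun_restrict (pruned_wedge s (F n) `&` pruned_wedge s L) h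
    + cfun_restrict (pruned_wedge s (F n) `&` ~` pruned_wedge s L) h
    + cfun_restrict (~` pruned_wedge s (F n)) m.
  apply: eval_at_inj => x; rewrite !eval_atD eval_atZ eval_indic//.
  rewrite !eval_restrict ?hE; last first.
  - exact: clopenI.
  - by apply: clopenI => //; exact: (clopenC set0).
  - exact: (clopenC set0).
  rewrite ![x \in pruned_wedge _ _ `&` _]in_setI !in_setC.
  have [xF|xF] /= := boolP (x \in pruned_wedge s (F n)); last first.
    by rewrite mulr0n mulr0 !add0r.
  by case: (x \in pruned_wedge s L) => /=; rewrite mulr1n mulr1 !addr0 ?subrKC.
have bound n : (n0 <= n)%N ->
    `|a| / 2 <= (`|a| + `|h| + `|m|) * n.+1%:R^-1.
  move=> n0n; have := mum n; rewrite [in mu n m](split_m n) !linearD linearZ/=.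
  set e := n.+1%:R^-1.
  set p1 := mu n (cfun_indic K _); set p2 := mu n _; set p3 := mu n _.
  set p4 := mu n _ => sum0.
  have p2le : `|p2| <= `|a| / 2.
    apply: le_trans (mu1 _ _) _; apply: norm_restrict_le; first exact: clopenI.
      by rewrite divr_ge0.
    by move=> x [_ /LD].
  have p3le : `|p3| <= e * `|h|.
    have nc : clopen (pruned_wedge s (F n) `&` ~` pruned_wedge s L : set (coarse_wedge T)).
      by apply: clopenI => //; exact: (clopenC set0).
    apply: le_trans (mutail n L _ sL _ _) _.
    - move=> x; rewrite eval_restrict//; case: ifPn; last by rewrite eqxx.
      by move=> /set_mem[[sx _] nLx] _; exact: not_pruned_wedge sx nLx.
    - move=> w x wF wx; rewrite eval_restrict//; case: ifPn => // /set_mem[].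
      move=> xF nLx; have [sx nFx] := xF.
      have [v vL vx] := not_pruned_wedge sx nLx.
      have vw : v = w.
        apply: immediate_successors_disjoint vx wx; first exact: LI.
        exact: succsP (sF n.+1) _ wF.
      by rewrite vw in vL; case/negP: (nFx w (n0P n n0n w vL wF)).
    - rewrite ler_wpM2l ?invr_ge0//; apply: norm_restrict_le => // x _.
      exact: eval_at_le.
  have p4le : `|p4| <= e * `|m|.
    have nc : clopen (~` pruned_wedge s (F n) : set (coarse_wedge T)).
      exact: (clopenC set0).
    apply: le_trans (mass_complement (mu1 n) (f := cfun_indic K (pruned_wedge s (F n)))
      (e := e) _ _ (mu_pruned n)) _.
    - move=> x; rewrite eval_indic// eval_restrict// in_setC.
      by case: (x \in pruned_wedge s (F n)); [right|left].
    - apply: norm_restrict_le => // x _; by rewrite eval_cfun1 normr1.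
    - rewrite ler_wpM2l ?invr_ge0//; apply: norm_restrict_le => // x _.
      exact: eval_at_le.
  have p1le : `|a| * (1 - e) <= `|a| / 2 + e * `|h| + e * `|m|.
    apply: (@le_trans _ _ `|a * p1|).
      by rewrite normrM ler_wpM2l// mu_pruned.
    have -> : a * p1 = - (p2 + p3 + p4).
      apply/eqP; rewrite -addr_eq0 !addrA; exact/eqP.
    rewrite normrN; apply: le_trans (ler_normD _ _) _; apply: lerD => //.
    by apply: le_trans (ler_normD _ _) _; apply: lerD.
  have ahalf : `|a| = `|a| / 2 + `|a| / 2 by rewrite -splitr.
  move: p1le; rewrite mulrBr mulr1 lerBlDr -!addrA {1}ahalf lerD2l.
  by rewrite ![e * _]mulrC -!mulrDl [`|m| + _]addrC [`|h| + _]addrCA addrA.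
have : `|a| / 2 = 0.
  apply: le_invn_eq0 bound; first by rewrite divr_ge0.
  by rewrite !addr_ge0.
by move/eqP; rewrite mulf_eq0 invr_eq0 pnatr_eq0 orbF normr_eq0 => /eqP.
Qed.

(** An element of [M] not vanishing at [s] is not killed by one of the countably
    many concentrating functionals, each of which kills all but countably many
    elements of [M]. *)
Theorem countable_support_index (S : set {linear CT -> K^o}) (M : set CT) s :
  coarse_wedge_index s -> norming 1 S ->
  S = [set f | dual f /\ countable [set m | M m /\ f m != 0]] ->
  countable [set m | M m /\ eval_at (s : coarse_wedge T) m != 0].
Proof.
move=> Is nS SE.
have [mu [F [muS sF Fhomo mu_pruned mutail]]] := concentrating_functionals Is nS.
apply: (@sub_countable _ _ _ (\bigcup_(n in [set: nat]) [set m | M m /\ mu n m != 0])).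
  apply: subset_card_le => m [Mm ms0]; apply: contrapT => nm.
  move: ms0; rewrite (@eval_at_eq0 s m mu F)// ?eqxx//.
    by move=> n; have [] := muS n.
  move=> n; apply/eqP; apply: contrapT => /negP mun0; apply: nm.
  by exists n.
apply: bigcup_countable => // n _; have [+ _] := muS n.
by rewrite SE => -[].
Qed.

End DiracApproximation.

(** * From Plichko spaces to Valdivia trees *)

Lemma continuous_ptwsP (X Y : topologicalType) (Gamma : Type)
    (h : X -> {ptws Gamma -> Y}) :
  continuous h <-> forall g, continuous (fun x => h x g).
Proof.
split=> [hc g x|hc x].
  have projc : (fun f : {ptws Gamma -> Y} => f g) @ nbhs (h x) --> h x g.
    have /(_ g) := (@cvg_sup _ _ (fun i => Topological.class
      (initial_topology (fun f : (forall _ : Gamma, Y) => f i))) _ (h x)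
      (nbhs_filter (h x))).1 (@cvg_id _ (nbhs (h x))).
    by move=> /cvg_app/cvg_trans; apply; exact: initial_continuous.
  exact: cvg_comp (hc x) projc.
apply/cvg_sup => g A; rewrite nbhsE => -[_ [[C oC <-] Cx] CA].
apply: filterS CA _; apply: (hc g x); exact: open_nbhs_nbhs.
Qed.

Lemma compact_embedding (R : realType) (X : compactType) (Gamma : eqType)
    (h : X -> {ptws Gamma -> R}) :
  injective h -> (forall g, continuous (fun x => h x g)) ->
  homeo_embedding h.
Proof.
move=> hinj hct.
have hc : continuous h by exact/continuous_ptwsP.
have hausd : hausdorff_space {ptws Gamma -> R}.
  apply: (@hausdorff_product Gamma (fun=> R)) => _; exact: Rhausdorff.
split => // U oU; exists (~` (h @` ~` U)).
  rewrite openC; apply: (compact_closed hausd); apply: continuous_compact.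
    by apply: continuous_subspaceT; exact: hc.
  apply: (subclosed_compact _ (@compact_setT X)) => //.
  by rewrite closedC.
apply/seteqP; split=> y.
  by move=> [x Ux <-]; split; [exists x|move=> [z nUz /hinj zx]; apply: nUz; rewrite zx].
move=> [[x _ <-] nUx]; exists x => //; apply: contrapT => nU.
by apply: nUx; exists x.
Qed.

Section Separation.
Context {d : Order.disp_t} {T : rootedChainCompleteTreeType d}.
Variable K : scalarFieldType.
Local Notation CT := (cfun (coarse_wedge T) K).

Lemma spanning_separates (M : set CT) (x y : coarse_wedge T) :
  closure (linear_span M) = [set: CT] ->
  (forall m, M m -> eval_at x m = eval_at y m) -> x = y.
Proof.
move=> dM xyM.
have key u v : (forall m, M m -> eval_at u m = eval_at v m) ->
    ((u : T) <= (v : T))%O.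
  move=> uvM; apply: contraT => /index_separates[t It /andP[tu ntv]].
  have ct := upset_clopen It.
  have : closure (linear_span M) (cfun_indic K (upset t : set (coarse_wedge T))).
    by rewrite dM.
  move=> /(_ (ball (cfun_indic K (upset t : set (coarse_wedge T))) 2^-1)).
  have h0 : 0 < 2^-1 :> K by rewrite invr_gt0.
  move=> /(_ (nbhsx_ballx _ _ h0))[_ [[n [a [m [Mm ->]]]] ]].
  rewrite -ball_normE /=; set f := \sum_(i < n) _ => fball.
  have fE : eval_at u f = eval_at v f.
    rewrite /f !linear_sum; apply: eq_bigr => i _.
    by rewrite !linearZ/= uvM.
  have /le_lt_trans/(_ fball) := eval_at_le u (cfun_indic K (upset t : set (coarse_wedge T)) - f).
  have /le_lt_trans/(_ fball) := eval_at_le v (cfun_indic K (upset t : set (coarse_wedge T)) - f).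
  have uI : u \in (upset t : set (coarse_wedge T)) by exact: mem_set.
  have vI : v \in (upset t : set (coarse_wedge T)) = false by apply: memNset; exact/negP.
  rewrite !eval_atB !eval_indic// uI vI.
  rewrite fE => lv lu; have := ltrD lu lv.
  have -> : 2^-1 + 2^-1 = 1 :> K by rewrite [RHS]splitr div1r.
  rewrite -[X in _ + X]normrN => /(le_lt_trans (ler_normD _ _)).
  by rewrite opprB subrKA subr0 normr1 ltxx.
by apply/le_anti; rewrite !key// => m Mm; rewrite xyM.
Qed.

(** The embedding evaluates at the elements of [M]; the maps [re] and [im] read
    the scalars in real coordinates, so that the real and the complex cases are
    treated at once. *)
Theorem plichko_valdivia (R : realType) (re im : K^o -> R) :
  continuous re -> continuous im -> re 0 = 0 -> im 0 = 0 ->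
  (forall z w, re z = re w -> im z = im w -> z = w) ->
  @plichko K CT 1 -> valdivia R (coarse_wedge T).
Proof.
move=> rec imc re0 im0 reim [S nS [M dM SE]].
pose h (x : coarse_wedge T) : {ptws (CT * bool)%type -> R} := fun p =>
  if `[< M p.1 >] then (if p.2 then re (eval_at x p.1) else im (eval_at x p.1))
  else 0.
have hP (x : coarse_wedge T) :
    countable [set p | h x p != 0] <-> countable [set m | M m /\ eval_at x m != 0].
  split => cx.
    have : countable (fst @` [set p | h x p != 0]).
      by apply: sub_countable cx; exact: card_image_le.
    apply: sub_countable; apply: subset_card_le => m [Mm mx].
    have [r0|r0] := eqVneq (re (eval_at x m)) 0; last first.
      by exists (m, true) => //=; rewrite /h /= asboolT.
    have [i0|i0] := eqVneq (im (eval_at x m)) 0; last first.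
      by exists (m, false) => //=; rewrite /h /= asboolT.
    by move: mx; rewrite (reim (eval_at x m) 0) ?re0 ?im0// eqxx.
  have : countable ([set m | M m /\ eval_at x m != 0] `*` [set: bool]).
    by apply: countableX.
  apply: sub_countable; apply: subset_card_le => -[m b]; rewrite /h /=.
  case: asboolP => Mm; last by rewrite eqxx.
  move=> hx; split => //=; split => //; apply: contraNneq hx => ->.
  by rewrite re0 im0; case: b.
exists [set x | countable [set p | h x p != 0]].
  exists (CT * bool)%type, h; split.
    apply: compact_embedding.
      move=> x y hxy; apply: (spanning_separates dM) => m Mm.
      apply: reim.
        by have := congr1 (@^~ (m, true)) hxy; rewrite /h/= asboolT.
      by have := congr1 (@^~ (m, false)) hxy; rewrite /h/= asboolT.
    move=> [m b]; rewrite /h /=; case: asboolP => _; last exact: cst_continuous.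
    by case: b => x; apply: (@continuous_comp _ _ _ (fun y => eval_at y m));
      by [exact: cfun_ct|exact: rec|exact: imc].
  apply/seteqP; split => y.
    by move=> [x hx <-]; split => //; exists x.
  by move=> [[x _ <-] hx]; exists x.
move=> U U0 oU; have [s [Us Is]] := @index_dense _ T U U0 oU.
by exists s; split => //; apply/hP; exact: countable_support_index nS SE.
Qed.

End Separation.

(** * From Valdivia compact spaces to Plichko spaces *)

Lemma countable_seqs (U : choiceType) (D : set U) : countable D ->
  countable [set L : seq U | forall C, C \in L -> D C].
Proof.
move=> /countable_injP[f finj]; apply/countable_injP.
exists (pickle \o map f) => L L' /set_mem DL /set_mem DL' /= /(pcan_inj pickleK).
elim: L L' DL DL' => [|C L IH] [|C' L']//= DL DL' [fC fL].
congr (_ :: _).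
  by apply: finj => //; apply: mem_set; [apply: DL|apply: DL']; rewrite mem_head.
by apply: IH => // c cL; [apply: DL|apply: DL']; rewrite inE cL orbT.
Qed.

Section ZeroDimensional.
Variable X : compactType.
Hypothesis clopenb : forall (x : X) (N : set X), nbhs x N ->
  exists2 U, clopen U /\ U x & U `<=` N.

Lemma clopen_between (E V : set X) : closed E -> open V -> E `<=` V ->
  exists2 C, clopen C & E `<=` C /\ C `<=` V.
Proof.
move=> cE oV EV.
have [||||C EC [cC CV]] := @compact_ind X E (fun U => clopen U /\ U `<=` V).
- exact: (subclosed_compact cE (@compact_setT X)).
- by split; [exact: clopen0|].
- by move=> A B [cA AV] [cB BV]; split; [exact: clopenU|move=> x []; [exact: AV|exact: BV]].
- move=> x /EV Vx; have /clopenb[U [cU Ux] UV] : nbhs x V by exact: open_nbhs_nbhs.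
  by exists U => //; apply: open_nbhs_nbhs; split => //; case: cU.
by exists C.
Qed.

(** The conditions [0 < q < r] make the family behave well: a member indexed by a
    coordinate only contains points at which this coordinate is not zero, and of
    two points differing at a coordinate, one lies further away from zero on one
    side, so that a sign and two rationals separate them. *)
Lemma valdivia_clopen_family (R : realType) : valdivia R X ->
  exists Cs : set (set X), [/\ Cs `<=` clopen,
    forall x y, x <> y -> exists2 C, Cs C & (C x /\ ~ C y) \/ (C y /\ ~ C x) &
    dense [set x | countable [set C | Cs C /\ C x]]].
Proof.
move=> [A [Gamma [h [[hinj hct _] hA]]] dA].
pose sg (i : Gamma * bool) x : R := if i.2 then h x i.1 else - h x i.1.
have sgct i : continuous (sg i).
  have hg := (continuous_ptwsP h).1 hct i.1.
  by rewrite /sg; case: i.2 => //= x; apply: cvgN; exact: hg.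
have between (i : Gamma * bool * (rat * rat)) : exists C : set X,
    0 < (ratr i.2.1 : R) < ratr i.2.2 -> [/\ clopen C,
      forall x, ratr i.2.2 <= sg i.1 x -> C x &
      forall x, C x -> ratr i.2.1 < sg i.1 x].
  case: i => i [q r] /=.
  have [/andP[q0 qr]|_] := boolP ((0 : R) < ratr q < ratr r); last by exists set0.
  have [|||C cC [EC CV]] := @clopen_between (sg i @^-1` [set z | ratr r <= z])
      (sg i @^-1` [set z | ratr q < z]).
  - apply: (closed_comp (fun x _ => sgct i x)); exact: closed_ge.
  - apply: (open_comp (fun x _ => sgct i x)); exact: open_gt.
  - by move=> x /=; exact: lt_le_trans.
  by exists C.
have [c cP] := choice between.
pose J := [set i : Gamma * bool * (rat * rat) | 0 < (ratr i.2.1 : R) < ratr i.2.2].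
have sep g b x y : sg (g, b) y < sg (g, b) x -> 0 < sg (g, b) x ->
    exists2 C, (c @` J) C & C x /\ ~ C y.
  move=> yx x0.
  have mx : Num.max 0 (sg (g, b) y) < sg (g, b) x by rewrite gt_max x0.
  have [r] := rat_in_itvoo mx; rewrite in_itv/= => /andP[mr rx].
  have [q] := rat_in_itvoo mr; rewrite in_itv/= => /andP[+ qr].
  rewrite gt_max => /andP[q0 yq].
  have Ji : J (g, b, (q, r)) by rewrite /J/= q0.
  have [_ rC Cq] := cP (g, b, (q, r)) Ji.
  exists (c (g, b, (q, r))); first by exists (g, b, (q, r)).
  split; first by apply: rC; exact: ltW.
  by move=> /Cq/= /(lt_trans yq); rewrite ltxx.
have sep2 g x y : h y g < h x g ->
    exists2 C, (c @` J) C & (C x /\ ~ C y) \/ (C y /\ ~ C x).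
  move=> yx; have [x0|x0] := ltP 0 (h x g).
    by have [C CC Cxy] := sep g true x y yx x0; exists C => //; left.
  have [||C CC Cyx] := sep g false y x; [| |by exists C => //; right].
    by rewrite /sg/= ltrN2.
  by rewrite /sg/= oppr_gt0 (lt_le_trans yx).
exists (c @` J); split.
- by move=> _ [i Ji <-]; have [] := cP i Ji.
- move=> x y xy; have [g /eqP] : exists g, h x g <> h y g.
    apply: contrapT => nog; apply: xy; apply: hinj; apply: functional_extensionality_dep => g.
    by apply: contrapT => hg; apply: nog; exists g.
  rewrite neq_lt => /orP[/sep2[C CC]|/sep2[C CC ?]]; last by exists C.
  by case=> ?; exists C => //; [right|left].
- move=> U U0 oU; have [a [Ua Aa]] := dA U U0 oU; exists a; split => //.
  have [_ /= ca] : (range h `&` @Sigma R Gamma) (h a) by rewrite -hA; exists a.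
  have : countable (c @` ([set g | h a g != 0] `*` [set: bool] `*` [set: rat * rat])).
    by apply: sub_countable (card_image_le _ _) _; do 2?apply: countableX.
  apply: sub_countable; apply: subset_card_le => _ [[i Ji <-] cia].
  exists i => //; split => //; split => //=.
  have [_ _ /(_ a cia)] := cP i Ji; move: Ji => /andP[+ _] => /lt_trans lti /lti.
  by rewrite /sg; case: i.1.2 => [/gt_eqF ->//|]; rewrite oppr_gt0 => /lt_eqF ->.
Qed.

End ZeroDimensional.

Section FamilyPlichko.
Variables (X : compactType) (K : scalarFieldType) (Cs : set (set X)).
Hypothesis Cs_clopen : Cs `<=` clopen.
Hypothesis Cs_sep : forall x y, x <> y ->
  exists2 C, Cs C & (C x /\ ~ C y) \/ (C y /\ ~ C x).
Hypothesis Cs_dense : dense [set x | countable [set C | Cs C /\ C x]].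
Local Notation CX := (cfun X K).

Definition inter (L : seq (set X)) : set X := [set x | forall C, C \in L -> C x].

Definition inter_indics : set CX :=
  [set cfun_indic K (inter L) | L in [set L : seq (set X) | forall C, C \in L -> Cs C]].

Lemma inter_cons C L : inter (C :: L) = C `&` inter L.
Proof.
apply/seteqP; split=> x.
  move=> CL; split; first by apply: CL; rewrite mem_head.
  by move=> C' C'L; apply: CL; rewrite inE C'L orbT.
by move=> [Cx Lx] C'; rewrite inE => /orP[/eqP ->//|]; exact: Lx.
Qed.

Lemma inter_clopen L : (forall C, C \in L -> Cs C) -> clopen (inter L).
Proof.
elim: L => [|C L IH] CL.
  rewrite (_ : inter [::] = setT); first exact: clopenT.
  by apply/seteqP; split.
rewrite inter_cons; apply: clopenI; first by apply: Cs_clopen; apply: CL; rewrite mem_head.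
by apply: IH => C' C'L; apply: CL; rewrite inE C'L orbT.
Qed.

Local Notation N := (linear_span inter_indics).

Lemma span_add f g : N f -> N g -> N (f + g).
Proof.
move=> [n [a [m [Mm ->]]]] [k [b [p [Mp ->]]]].
exists (n + k)%N.
exists (fun i : 'I_(n + k) => match fintype.split i with inl j => a j | inr j => b j end).
exists (fun i : 'I_(n + k) => match fintype.split i with inl j => m j | inr j => p j end).
split; first by move=> i; case: (fintype.split i).
rewrite big_split_ord /=; congr (_ + _); apply: eq_bigr => i _.
  by rewrite (unsplitK (inl i)).
by rewrite (unsplitK (inr i)).
Qed.

Lemma span_scale (c : K) f : N f -> N (c *: f).
Proof.
move=> [n [a [m [Mm ->]]]]; exists n, (fun i => c * a i), m; split => //.
by rewrite scaler_sumr; apply: eq_bigr => i _; rewrite scalerA.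
Qed.

Lemma span_mem m : inter_indics m -> N m.
Proof.
by move=> Mm; exists 1%N, (fun=> 1), (fun=> m); rewrite big_ord1 scale1r.
Qed.

Lemma span_one : N (cfun1 X K).
Proof.
apply: span_mem; exists [::] => //; apply: eval_at_inj => x.
rewrite eval_indic; last exact: inter_clopen.
by rewrite mem_set.
Qed.

(** The span of the indicators is an algebra; only multiplication by indicators,
    that is restriction to clopen sets, is needed, and the sets for which it
    preserves the span form a Boolean algebra. *)
Definition span_stable (U : set X) := clopen U /\ forall f, N f -> N (cfun_restrict U f).

Lemma span_stable_family C : Cs C -> span_stable C.
Proof.
move=> CC; have cC := Cs_clopen CC; split => // f [n [a [m [Mm ->]]]].
exists n, a, (fun i => cfun_restrict C (m i)); split.
  move=> i; have [L CL <-] := Mm i; exists (C :: L).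
    by move=> C'; rewrite inE => /orP[/eqP ->//|]; exact: CL.
  have cL := inter_clopen CL.
  apply: eval_at_inj => x; rewrite inter_cons eval_indic; last exact: clopenI.
  rewrite eval_restrict// eval_indic// [x \in C `&` _]in_setI.
  by case: (x \in C).
apply: eval_at_inj => x; rewrite eval_restrict// !linear_sum.
case: ifPn => xC; last first.
  by rewrite big1// => i _; rewrite linearZ/= eval_restrict// (negbTE xC) scaler0.
by apply: eq_bigr => i _; rewrite !linearZ/= eval_restrict// xC.
Qed.

Lemma span_stable_set0 : span_stable set0.
Proof.
split; first exact: clopen0.
move=> f Nf; rewrite (_ : cfun_restrict _ _ = 0 *: f); first exact: span_scale.
apply: eval_at_inj => y; rewrite eval_restrict; last exact: clopen0.
by rewrite in_set0 eval_atZ mul0r.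
Qed.

Lemma span_stable_setC U : span_stable U -> span_stable (~` U).
Proof.
move=> [cU gU]; have cUc : clopen (~` U) by exact: (clopenC set0).
split=> // f Nf.
rewrite (_ : cfun_restrict _ f = f + (-1) *: cfun_restrict U f).
  by apply: span_add => //; apply: span_scale; exact: gU.
apply: eval_at_inj => x; rewrite eval_atD eval_atZ !eval_restrict// in_setC mulN1r.
by case: (x \in U); rewrite ?subrr ?subr0.
Qed.

Lemma span_stable_setI U V : span_stable U -> span_stable V -> span_stable (U `&` V).
Proof.
move=> [cU gU] [cV gV]; have cUV := clopenI cU cV; split => // f Nf.
rewrite (_ : cfun_restrict _ f = cfun_restrict U (cfun_restrict V f)).
  by apply: gU; exact: gV.
apply: eval_at_inj => x; rewrite !eval_restrict// in_setI.
by case: (x \in U).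
Qed.

Lemma span_stable_setU U V : span_stable U -> span_stable V -> span_stable (U `|` V).
Proof.
move=> gU gV; rewrite -[U `|` V]setCK setCU.
by apply: span_stable_setC; apply: span_stable_setI; exact: span_stable_setC.
Qed.

Lemma clopen_nbhs (x : X) U : clopen U -> U x -> nbhs x U.
Proof. by move=> [oU _] Ux; exact: open_nbhs_nbhs. Qed.

(** A point is separated from each point of the compact complement of [V] by a
    member of the Boolean algebra; finitely many of these suffice. *)
Lemma span_stable_base (x : X) V : open V -> V x -> exists2 G, span_stable G & G x /\ G `<=` V.
Proof.
move=> oV Vx.
have [||||G VG [gG nGx]] := @compact_ind X (~` V) (fun U => span_stable U /\ ~ U x).
- by apply: (subclosed_compact _ (@compact_setT X)) => //; rewrite closedC.
- by split => //; exact: span_stable_set0.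
- move=> A B [gA nAx] [gB nBx]; split; [exact: span_stable_setU|by move=> []].
- move=> y nVy; have yx : y <> x by move=> yx; apply: nVy; rewrite yx.
  have [C CC [[Cy nCx]|[Cx nCy]]] := Cs_sep yx.
    have gC := span_stable_family CC; exists C; last by [].
    by apply: clopen_nbhs => //; exact: gC.1.
  have gC := span_stable_setC (span_stable_family CC); exists (~` C); last by split => // /(_ Cx).
  by apply: clopen_nbhs => //; exact: gC.1.
exists (~` G); first exact: span_stable_setC.
by split => // y nGy; apply: contrapT => nVy; apply: nGy; exact: VG.
Qed.

(** Uniform approximations on two sets of the Boolean algebra can be glued, and
    locally a continuous function is approximated by a constant. *)
Lemma span_dense : closure N = [set: CX].
Proof.
apply/seteqP; split => // f _ B /nbhs_ballP[e /= e0 eB].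
have e20 : 0 < e / 2 by rewrite divr_gt0.
have [||||G TG [gG [g Ng fg]]] := @compact_ind X setT (fun U => span_stable U /\
  exists2 g, N g & forall x, U x -> `|eval_at x (f - g)| <= e / 2).
- exact: compact_setT.
- split; first exact: span_stable_set0.
  by exists (cfun1 X K) => //; exact: span_one.
- move=> U V [gU [g Ng fg]] [gV [h Nh fh]]; split; first exact: span_stable_setU.
  have gUc := span_stable_setC gU.
  exists (cfun_restrict U g + cfun_restrict (~` U) h).
    by apply: span_add; [exact: gU.2|exact: gUc.2].
  move=> x UVx; rewrite eval_atB eval_atD.
  rewrite eval_restrict; last exact: gU.1.
  rewrite eval_restrict; last exact: gUc.1.
  rewrite in_setC; case: ifPn => /= xU; first by rewrite addr0; apply: fg; exact: set_mem.
  rewrite add0r; apply: fh; case: UVx => // Ux; by rewrite mem_set in xU.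
- move=> x _.
  have : nbhs x [set y | `|eval_at x f - eval_at y f| <= e / 2].
    by have /cvgrPdist_le/(_ _ e20) := @cfun_ct X K f x.
  rewrite {1}nbhsE => -[V [oV Vx] VE].
  have [G gG [Gx GV]] := span_stable_base oV Vx.
  exists G; first exact: (clopen_nbhs gG.1 Gx).
  split => //; exists (eval_at x f *: cfun1 X K).
    by apply: span_scale; exact: span_one.
  move=> y /GV/VE /= xy.
  by rewrite eval_atB eval_atZ eval_cfun1 mulr1 distrC.
exists g; split => //; apply: eB; rewrite -ball_normE /=.
have /le_lt_trans : `|f - g| <= e / 2.
  by apply: norm_le_eval; [exact: ltW|move=> x; exact/fg/TG].
by apply; rewrite ltr_pdivrMr// ltr_pMr// ltr1n.
Qed.

(** If the absolute value of [f] exceeded at some point the supremum over the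
    evaluations in the Sigma-subspace, it would do so on an open set, hence at a
    point of the dense set. *)
Theorem family_plichko : @plichko K CX 1.
Proof.
pose S := [set mu : {linear CX -> K^o} |
  dual mu /\ countable [set m | inter_indics m /\ mu m != 0]].
exists S; last by exists inter_indics => //; exact: span_dense.
have SA (x : X) : countable [set C | Cs C /\ C x] -> S (eval_at x).
  move=> cx; split; first exact: eval_at_dual.
  have : countable ((fun L : seq (set X) => cfun_indic K (inter L)) @`
      [set L : seq (set X) | forall C, C \in L -> Cs C /\ C x]).
    by apply: sub_countable (countable_seqs cx); exact: card_image_le.
  apply: sub_countable; apply: subset_card_le => _ [[L CL <-] mx].
  exists L => // C CL'; split; first exact: CL.
  move: mx => /=; rewrite eval_indic; last exact: inter_clopen.
  by have [/set_mem/(_ C CL')//|] := boolP (x \in inter L); rewrite eqxx.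
have BA (x : X) : dual_unit_ball (eval_at x : {linear CX -> K^o}).
  by apply: contraction_dual_unit_ball => f; exact: eval_at_le.
move=> f; rewrite mul1r.
set A := [set _ | _ in _].
have hA : A !=set0 -> has_sup A.
  move=> A0; split => //; exists `|f| => _ [mu [_ Bmu] <-].
  exact: dual_unit_ball_le.
have Aeval x : countable [set C | Cs C /\ C x] -> A `|eval_at x f|.
  by move=> cx; exists (eval_at x : {linear CX -> K^o}) => //; split; [exact: SA|exact: BA].
have s0 : 0 <= supremum 0 A.
  have [->|/set0P A0] := eqVneq A set0; first by rewrite supremum0.
  have [z Az] := A0; apply: le_trans (supremum_ub (hA A0) Az).
  by case: Az => mu _ <-.
apply: norm_le_eval => // x; rewrite real_leNgt ?normr_real ?ger0_real//.
apply/negP => ltx.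
have oU : open [set y | supremum 0 A < `|eval_at y f|].
  rewrite openE => y /= sy.
  have d0 : 0 < `|eval_at y f| - supremum 0 A by rewrite subr_gt0.
  have /cvgrPdist_lt/(_ _ d0) := @cfun_ct X K f y.
  apply: filterS => z /= yz.
  by have := le_lt_trans (lerB_dist _ _) yz; rewrite ltrD2l ltrN2.
have [|y [/= lty cy]] := Cs_dense _ oU; first by exists x.
have /supremum_ub : has_sup A by apply: hA; exists `|eval_at y f|; exact: Aeval.
by move=> /(_ _ (Aeval y cy)) /(lt_le_trans lty); rewrite ltxx.
Qed.

End FamilyPlichko.

(** * The equivalence for trees *)

Lemma valdivia_plichko (R : realType) (d : Order.disp_t)
    (T : rootedChainCompleteTreeType d) (K : scalarFieldType) :
  valdivia R (coarse_wedge T) -> @plichko K (cfun (coarse_wedge T) K) 1.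
Proof.
move=> /(valdivia_clopen_family (@clopen_base d T))[Cs [cC sC dC]].
exact: family_plichko cC sC dC.
Qed.

Theorem theorem4p1 (R : realType) (d : Order.disp_t)
    (T : rootedChainCompleteTreeType d) :
  (valdivia R (coarse_wedge T) <-> @plichko R (cfun (coarse_wedge T) R) 1%R) /\
  (valdivia R (coarse_wedge T) <->
     @plichko (R[i])%type (cfun (coarse_wedge T) (R[i])%type) 1%R).
Proof.
split; split; try exact: valdivia_plichko.
  apply: (@plichko_valdivia _ _ R R id (fun=> 0)) => //.
  - by move=> x; exact: cvg_id.
  - exact: cst_continuous.
(* The real and imaginary parts are additive contractions, hence continuous. *)
have ct (g : {additive R[i] -> R}) : (forall z, `|g z|%:C%C <= `|z|) ->
    forall z : R[i]^o, g @ nbhs z --> g z.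
  move=> gle z; apply/(cvgrPdist_lt (FF := nbhs_filter (z : R[i]^o))) => e e0.
  have e0C : 0 < e%:C%C :> R[i] by rewrite ltcR.
  apply/(@nbhs_ballP _ R[i]^o); exists e%:C%C => // w zw.
  rewrite -raddfB -ltcR.
  exact: le_lt_trans (gle _) zw.
apply: (@plichko_valdivia _ _ R[i]%type R (@complex.Re R) (@complex.Im R)) => //.
- by apply: ct => z; exact: normc_ge_Re.
- apply: ct => z; rewrite normc_def lecR -sqrtr_sqr ler_wsqrtr // lerDr sqr_ge0 //.
- by move=> [a b] [a' b'] /= -> ->.
Qed.
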